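(* For all integers $k\ge h\ge 1$, $$\widetilde{D}_1(e_ke_h)=2\sum_{i=0}^{h-1}(k-h+1+2i)\,e_{k+i}e_{h-1-i}.$$
   Context: Let $n\ge 2$ and let $e_k=e_k(x_2,x_3,\dots,x_n)$ be the elementary symmetric polynomial of degree $k$ in the $n-1$ variables $x_2,\dots,x_n$ ($e_0=1$, and $e_k=0$ for $k<0$ or $k>n-1$). $\widetilde{D}_1=\sum_{i=1}^n x_i\partial_i^2$ with $\partial_i=\partial/\partial x_i$. *)

(* Defs.v *)
From mathcomp Require Import all_boot all_order all_algebra.
From mathcomp Require Export mpoly.

Set Implicit Arguments.
Unset Strict Implicit.
Unset Printing Implicit Defensive.

Import GRing.Theory.
Local Open Scope ring_scope.

(* The variables x_1, ..., x_n are 'X_i for i = 0, ..., n-1, so x_2, ..., x_n are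
   the 'X_(ord_shift i). *)

Fact ord_shift_subproof (n : nat) (i : 'I_n.-1) : (i.+1 < n)%N.
Proof. by rewrite -ltn_predRL. Qed.

Definition ord_shift (n : nat) (i : 'I_n.-1) : 'I_n :=
  Ordinal (ord_shift_subproof i).

(* The library's mesym in n - 1 variables, evaluated at x_2, ..., x_n. *)
Definition esym_tail (R : comNzRingType) (n k : nat) : {mpoly R[n]} :=
  mesym n.-1 R k \mPo [tuple 'X_(ord_shift i) | i < n.-1].

Lemma esym_tail0 (R : comNzRingType) (n : nat) : esym_tail R n 0 = 1.
Proof. by rewrite /esym_tail mesym0E comp_mpoly1. Qed.

Lemma esym_tail_gt (R : comNzRingType) (n k : nat) :
  (n.-1 < k)%N -> esym_tail R n k = 0.
Proof. by move=> lt_nk; rewrite /esym_tail mesym_geqnE // comp_mpoly0. Qed.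

Definition D1 (R : comNzRingType) (n : nat) (p : {mpoly R[n]}) : {mpoly R[n]} :=
  \sum_(i < n) 'X_i * p^`M(i)^`M(i).

(* Main.v *)
Require Import Defs.
From mathcomp Require Import all_boot all_order all_algebra.
From mathcomp Require Import ring zify.

(** Write [e_k] for the [k]-th elementary symmetric polynomial in a family of
    distinct variables [x_i], and [d_i] for the derivative in [x_i].  Each
    monomial of [e_k] is squarefree, so [d_i (d_i e_k) = 0], and the operator
    [D1] sends [e_k * e_h] to [2 F(k, h)], where [F(k, h)] is the sum over [i]
    of [x_i * d_i e_k * d_i e_h] (the variables outside the family contribute
    nothing).

    Two facts determine [F].  The first is
    [d_i e_(k+1) = e_k - x_i * d_i e_k] ([mderiv_esymS]): both sides are the
    elementary symmetric polynomial of degree [k] in the variables other than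
    [x_i].  The second is Euler's identity, that the sum of the
    [x_i * d_i e_k] is [k e_k] ([euler_esym]).  Substituting the first for
    [d_i e_(h+1)] in [F(k, h+1)], and for [d_i e_(k+1)] in [F(k+1, h)], leaves
    the same remainder, the sum of the [x_i^2 * d_i e_k * d_i e_h]; so by
    Euler
    [F(k, h+1) - F(k+1, h) = (k - h) e_k e_h] ([gamma_esym_exchange]).
    As [F(k, 0) = 0], moving all the degree to the first index makes the sum
    telescope into the stated one ([gamma_esymE]). *)

Set Implicit Arguments.
Unset Strict Implicit.
Unset Printing Implicit Defensive.

Import GRing.Theory.
Local Open Scope ring_scope.

(** * Squarefree monomials and their derivatives *)

Lemma mderivU (R : comNzRingType) (n : nat) (i l : 'I_n) :
  ('X_i : {mpoly R[n]})^`M(l) = (i == l)%:R.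
Proof.
rewrite mderivX mnm1E; case: eqP => [->|_]; last by rewrite scale0r.
have -> : (U_(l) - U_(l))%MM = 0%MM :> 'X_{1..n}.
  by apply/mnmP=> j; rewrite mnmBE mnm0E subnn.
by rewrite mpolyX0 scale1r.
Qed.

Section ElementarySymmetric.

(** The family of variables is indexed by an arbitrary finite type, so that
    the variables [x_2, ..., x_n] can be treated inside the ring of
    polynomials in all [n] variables, without a chain rule for [\mPo]. *)
Variables (R : comNzRingType) (n : nat) (T : finType) (f : T -> 'I_n).
Hypothesis f_inj : injective f.

Local Notation mpoly := {mpoly R[n]}.

Definition sqfree (B : {set T}) : mpoly := \prod_(j in B) 'X_(f j).

Definition esym (k : nat) : mpoly := \sum_(B : {set T} | #|B| == k) sqfree B.

Lemma mderiv_sqfree_out (l : 'I_n) (B : {set T}) :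
  (forall j, j \in B -> f j != l) -> (sqfree B)^`M(l) = 0.
Proof.
move=> Bl; rewrite /sqfree; apply: (big_ind (fun p : mpoly => p^`M(l) = 0)).
- by rewrite -mpolyC1 mderivC.
- by move=> p q dp dq; rewrite mderivM dp dq mul0r mulr0 addr0.
- by move=> j /Bl /negbTE fjl; rewrite mderivU fjl.
Qed.

Lemma mderiv_sqfree_notin (i : T) (B : {set T}) :
  i \notin B -> (sqfree B)^`M(f i) = 0.
Proof.
move=> iB; apply: mderiv_sqfree_out => j jB.
by rewrite (inj_eq f_inj); apply: contraNneq iB => <-.
Qed.

Lemma sqfreeD1 (i : T) (B : {set T}) :
  i \in B -> sqfree B = 'X_(f i) * sqfree (B :\ i).
Proof. by move=> iB; rewrite /sqfree (big_setD1 i). Qed.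

Lemma mderiv_sqfree_in (i : T) (B : {set T}) :
  i \in B -> (sqfree B)^`M(f i) = sqfree (B :\ i).
Proof.
move=> iB; rewrite (sqfreeD1 iB) mderivM mderivU eqxx mul1r.
by rewrite mderiv_sqfree_notin ?setD11 // mulr0 addr0.
Qed.

Lemma euler_sqfree (i : T) (B : {set T}) :
  'X_(f i) * (sqfree B)^`M(f i) = if i \in B then sqfree B else 0.
Proof.
case: ifPn => iB; last by rewrite mderiv_sqfree_notin ?mulr0.
by rewrite mderiv_sqfree_in // -sqfreeD1.
Qed.

(** * Differential identities for elementary symmetric polynomials *)

Lemma mderiv_esym (l : 'I_n) (k : nat) :
  (esym k)^`M(l) = \sum_(B : {set T} | #|B| == k) (sqfree B)^`M(l).
Proof. by rewrite raddf_sum. Qed.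

Lemma mderiv_esym_out (l : 'I_n) (k : nat) :
  (forall j, f j != l) -> (esym k)^`M(l) = 0.
Proof.
move=> fl; rewrite mderiv_esym big1 //= => B _.
by apply: mderiv_sqfree_out => j _.
Qed.

Lemma mderiv2_esym (i : T) (k : nat) : (esym k)^`M(f i)^`M(f i) = 0.
Proof.
rewrite mderiv_esym raddf_sum big1 //= => B _.
have [iB|iB] := boolP (i \in B); last by rewrite mderiv_sqfree_notin // mderiv0.
by rewrite mderiv_sqfree_in // mderiv_sqfree_notin ?setD11.
Qed.

Lemma mderiv_esym0 (i : T) : (esym 0)^`M(f i) = 0.
Proof.
rewrite mderiv_esym big1 //= => B /eqP/cards0_eq ->.
by rewrite mderiv_sqfree_notin ?inE.
Qed.

(** Removing [i] is a bijection from the sets of size [k+1] containing [i] to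
    the sets of size [k] avoiding it; the latter index what is left of
    [esym k] once its monomials divisible by ['X_(f i)], which make up
    ['X_(f i) * (esym k)^`M(f i)], are taken away. *)
Lemma mderiv_esymS (i : T) (k : nat) :
  (esym k.+1)^`M(f i) = esym k - 'X_(f i) * (esym k)^`M(f i).
Proof.
have -> : (esym k.+1)^`M(f i) =
    \sum_(B : {set T} | (#|B| == k) && (i \notin B)) sqfree B.
  rewrite mderiv_esym /= (bigID (fun B : {set T} => i \in B)) /=.
  rewrite [X in _ + X]big1 ?addr0; last first.
    by move=> B /andP[_]; apply: mderiv_sqfree_notin.
  rewrite (reindex_onto (fun B => i |: B) (fun B => B :\ i)) /=; last first.
    by move=> B /andP[_]; apply: setD1K.
  apply: eq_big => B.
    rewrite setU11 andbT cardsU1; have [iB|iB] := boolP (i \in B).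
      rewrite andbF; apply/negbTE; rewrite negb_and; apply/orP; right.
      by apply: contraTneq iB => <-; rewrite setD11.
    by rewrite setU1K // eqxx !andbT add1n eqSS.
  by move=> /andP[_ /eqP BE]; rewrite mderiv_sqfree_in ?setU11 // BE.
rewrite mderiv_esym mulr_sumr /= -sumrB big_mkcondr /=.
apply: eq_bigr => B _; rewrite euler_sqfree.
by case: (i \in B); rewrite ?subrr ?subr0.
Qed.

Lemma euler_esym (k : nat) :
  \sum_i 'X_(f i) * (esym k)^`M(f i) = k%:R * esym k.
Proof.
under eq_bigr do rewrite mderiv_esym mulr_sumr /=.
rewrite exchange_big mulr_sumr /=; apply: eq_bigr => B /eqP <-.
under eq_bigr do rewrite euler_sqfree.
by rewrite -big_mkcond /= sumr_const mulr_natl.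
Qed.

(** * The bilinear form *)

(** Half of the failure of the sum of the ['X_(f i) * d_i^2] to be a
    derivation, that is, its carré du champ. *)
Definition gamma (p q : mpoly) : mpoly :=
  \sum_i 'X_(f i) * p^`M(f i) * q^`M(f i).

(** The terms [x_i^2 * d_i e_k * d_i e_h] arising on the two sides from
    [mderiv_esymS] cancel, which leaves two instances of Euler's identity. *)
Lemma gamma_esym_exchange (k h : nat) :
  gamma (esym k) (esym h.+1) =
    gamma (esym k.+1) (esym h) + (k%:R - h%:R) * esym k * esym h.
Proof.
have -> : (k%:R - h%:R) * esym k * esym h =
    \sum_i (('X_(f i) * (esym k)^`M(f i)) * esym h
            - ('X_(f i) * (esym h)^`M(f i)) * esym k).
  by rewrite sumrB -!mulr_suml !euler_esym; ring.
rewrite -big_split; apply: eq_bigr => i _ /=.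
by rewrite !mderiv_esymS; ring.
Qed.

Lemma gamma_esymE (k h : nat) : (h <= k)%N ->
  gamma (esym k) (esym h) =
    \sum_(0 <= i < h)
      (k - h + 1 + 2 * i)%:R * esym (k + i) * esym (h - 1 - i).
Proof.
elim: h k => [|h IH] k hk.
  by rewrite big_geq // /gamma big1 // => i _; rewrite mderiv_esym0 mulr0.
have hk1 : (h <= k.+1)%N by lia.
rewrite gamma_esym_exchange (IH _ hk1) addrC big_nat_recl //; congr (_ + _).
  rewrite -natrB; last exact: ltnW.
  have -> : (k - h.+1 + 1 + 2 * 0 = k - h)%N by lia.
  have -> : (h.+1 - 1 - 0 = h)%N by lia.
  by rewrite addn0.
apply: eq_big_nat => i /andP[_ ih].
have -> : (k.+1 - h + 1 + 2 * i = k - h.+1 + 1 + 2 * i.+1)%N by lia.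
have -> : (k.+1 + i = k + i.+1)%N by lia.
by have -> : (h - 1 - i = h.+1 - 1 - i.+1)%N by lia.
Qed.

End ElementarySymmetric.

(** * The operator on the polynomials in the last variables *)

Lemma ord_shift_inj (n : nat) : injective (@ord_shift n).
Proof. by move=> i j [/val_inj]. Qed.

Lemma esym_tailE (R : comNzRingType) (n k : nat) :
  esym_tail R n k = esym R (@ord_shift n) k.
Proof.
rewrite /esym_tail /mesym raddf_sum; apply: eq_bigr => B _ /=.
rewrite rmorph_prod; apply: eq_bigr => i _ /=.
by rewrite comp_mpolyXU -tnth_nth tnth_mktuple.
Qed.

(** The first variable contributes nothing, and neither do the pure second
    derivatives, so only the cross terms of the product rule remain. *)
Lemma D1_esym_mul (R : comNzRingType) (n k h : nat) :
  let e := esym R (@ord_shift n) in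
  D1 (e k * e h) = 2%:R * gamma (@ord_shift n) (e k) (e h).
Proof.
case: n => [|n] /=; first by rewrite /D1 /gamma !big_ord0 mulr0.
have D0 j : (esym R (@ord_shift n.+1) j)^`M(ord0) = 0.
  by apply: mderiv_esym_out.
rewrite /D1 /gamma big_ord_recl mderivM !D0 mul0r mulr0 addr0 mderiv0 mulr0.
rewrite add0r mulr_sumr; apply: eq_bigr => i _.
have -> : lift ord0 i = @ord_shift n.+1 i by apply: val_inj.
rewrite !(mderivM, mderivD) !mderiv2_esym; try exact: ord_shift_inj.
by ring.
Qed.

Theorem lemma5p2 (R : comNzRingType) (n : nat) (hn : (2 <= n)%N)
    (k h : nat) (hh : (1 <= h)%N) (hk : (h <= k)%N) :
  D1 (esym_tail R n k * esym_tail R n h) =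
    2%:R * \sum_(0 <= i < h)
      (k - h + 1 + 2 * i)%:R * esym_tail R n (k + i) * esym_tail R n (h - 1 - i).
Proof.
rewrite !esym_tailE D1_esym_mul (gamma_esymE R (@ord_shift_inj n) hk).
by congr (_ * _); apply: eq_bigr => i _; rewrite !esym_tailE.
Qed.
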